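(* There is $\epsilon>0$ such that, for every $1\le i\le n-1$ and every $\lambda_0>0$ with $\lambda_0\in(\lambda^G_i-\epsilon,\lambda^G_i+\epsilon)$, the sequence $(\lambda_\ell)_{\ell=1}^\infty$ defined by $\lambda_{\ell+1}=\mathcal{L}(\lambda_\ell)$ for $\ell\ge0$ is monotonic and converges to $\lambda^G_i$.
   Context: Let $n\ge2$, $V=\{1,\dots,n\}$, $E=\{\{i,i+1\}:1\le i\le n-1\}$, $G=(V,E)$. Let $\pi$ be a positive measure on $V$ with $\pi(V)=\sum_i\pi(i)=1$ and $\nu$ a positive measure on $E$ (write $\nu(i,i+1)=\nu(i+1,i)>0$), with the convention $\nu(0,1)=\nu(n,n+1)=0$ (terms multiplied by these coefficients vanish). Put $\pi(f)=\sum_i f(i)\pi(i)$, $\mathcal{E}_\nu(f,f)=\sum_{i=1}^{n-1}[f(i)-f(i+1)]^2\nu(i,i+1)$, $\mathrm{Var}_\pi(f)=\pi(f^2)-\pi(f)^2$. Let $M^G_{\pi,\nu}$ be the $n\times n$ matrix with entries $M(i,j)=-\nu(i,j)/\pi(i)$ if $|i-j|=1$, $M(i,i)=[\nu(i-1,i)+\nu(i,i+1)]/\pi(i)$, and $0$ otherwise; its eigenvalues are real and simple, $0=\lambda^G_0<\lambda^G_1<\dots<\lambda^G_{n-1}$. For $\lambda\in\mathbb{R}$, $\xi_\lambda:V\to\mathbb{R}$ is defined by $\xi_\lambda(1)=-1$ and, for $1\le k<n$, $\xi_\lambda(k+1)=\xi_\lambda(k)+\frac{[\xi_\lambda(k)-\xi_\lambda(k-1)]\nu(k-1,k)-\lambda\pi(k)\xi_\lambda(k)}{\nu(k,k+1)}$.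 For $\lambda>0$ (then $\xi_\lambda$ is non-constant) let $\mathcal{L}(\lambda)=\mathcal{E}_\nu(\xi_\lambda,\xi_\lambda)/\mathrm{Var}_\pi(\xi_\lambda)$. *)

(* Defs.v *)
From mathcomp Require Import all_boot all_order all_algebra.
From mathcomp Require Import polyrcf.
From mathcomp Require Import reals.

Set Implicit Arguments.
Unset Strict Implicit.
Unset Printing Implicit Defensive.

Import Order.TTheory GRing.Theory Num.Theory.
Local Open Scope ring_scope.

(* A vertex is a natural number in {1, ..., n}; the edge {i, i+1} is encoded  *)
(* by its left end, i.e. [nu i] is the weight of {i, i+1}. [nu 0] and [nu n]  *)
(* are the boundary weights, which [weighted_path] sets to 0. Other values of *)
(* [pi] and [nu] outside these ranges are never used.                         *)

Record weighted_path (R : realType) (n : nat) (pi nu : nat -> R) : Prop := {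
  vertex_gt0 : forall i : nat, (1 <= i <= n)%N -> 0 < pi i;
  vertex_sum1 : \sum_(1 <= i < n.+1) pi i = 1;
  edge_gt0 : forall i : nat, (1 <= i < n)%N -> 0 < nu i;
  edge_left0 : nu 0 = 0;
  edge_right0 : nu n = 0 }.

Definition mean (R : realType) (n : nat) (pi f : nat -> R) : R :=
  \sum_(1 <= i < n.+1) f i * pi i.

Definition dirichlet (R : realType) (n : nat) (nu f : nat -> R) : R :=
  \sum_(1 <= i < n) (f i - f i.+1) ^+ 2 * nu i.

Definition variance (R : realType) (n : nat) (pi f : nat -> R) : R :=
  mean n pi (fun i => f i ^+ 2) - mean n pi f ^+ 2.

Definition path_entry (R : realType) (pi nu : nat -> R) (v w : nat) : R :=
  if v == w then (nu v.-1 + nu v) / pi v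
  else if (w == v.+1) || (v == w.+1) then - nu (minn v w) / pi v
  else 0.

(* The index [i : 'I_n] stands for the vertex [i.+1]. *)
Definition path_matrix (R : realType) (n : nat) (pi nu : nat -> R) : 'M[R]_n :=
  \matrix_(i < n, j < n) path_entry pi nu i.+1 j.+1.

(* [rootsR] lists the distinct real roots of a polynomial in increasing       *)
(* order, so that this is the i-th smallest eigenvalue, counting from 0.      *)
Definition path_eigenvalue (R : realType) (n : nat) (pi nu : nat -> R)
    (i : nat) : R :=
  (rootsR (char_poly (path_matrix n pi nu)))`_i.

(* The value at 0 is a dummy: it only occurs multiplied by [nu 0]. *)
Fixpoint xi (R : realType) (pi nu : nat -> R) (lam : R) (v : nat) : R :=
  if v is k.+1 then
    if k is j.+1 then
      xi pi nu lam k
      + ((xi pi nu lam k - xi pi nu lam j) * nu j - lam * pi k * xi pi nu lam k)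
        / nu k
    else -1
  else 0.

Definition rayleigh (R : realType) (n : nat) (pi nu : nat -> R) (lam : R) : R :=
  dirichlet n nu (xi pi nu lam) / variance n pi (xi pi nu lam).

(* Main.v *)
Require Import Defs.
From mathcomp Require Import all_boot all_order all_algebra.
From mathcomp Require Import polyrcf complex.
From mathcomp Require Import all_classical all_reals all_analysis.
From mathcomp Require Import ring lra.

Set Implicit Arguments.
Unset Strict Implicit.
Unset Printing Implicit Defensive.

Import Order.TTheory GRing.Theory Num.Theory.
Import numFieldNormedType.Exports.
Local Open Scope classical_set_scope.
Local Open Scope ring_scope.

(** Let [x_mu] be the solution [xi] of the recurrence with parameter [mu], and
    [F(lam) = lam * mean(x_lam)] the defect by which [x_lam] fails the
    eigenvalue equation at the last vertex. The eigenvalues are the roots of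
    the polynomial [F]. Summation by parts (the Christoffel-Darboux identity)
    gives
      [(lam - mu) * <x_lam, x_mu> = F(lam) * x_mu(n) - x_lam(n) * F(mu)].
    Over the complex numbers, with [mu] the conjugate of a root [lam], it shows
    that the roots are real; with an indeterminate in place of [lam] it shows
    that they are simple ([residual_roots_exist]). As [F] has degree [n], there
    are [n] eigenvalues ([spectrumP]) and the [x_mu] form an orthogonal basis.
    In this basis the coefficient of [x_lam] along [x_mu] is proportional to
    [x_mu(n) / (lam - mu)], so with positive weights [w]
      [L(lam) = (sum_mu mu * w(mu) / (lam - mu)^2) / (sum_mu w(mu) / (lam - mu)^2)]
    over the nonzero eigenvalues [mu]. Near a positive eigenvalue [x], with
    [t = lam - x], this is
      [L(lam) - x = t^2 * S(lam) / (w(x) + t^2 * T(lam))], where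
      [S(lam) = sum_(mu <> 0, x) (mu - x) * w(mu) / (lam - mu)^2] and [T >= 0]
    ([rayleigh_displacement]).

    So [x] attracts quadratically, which gives convergence. Monotonicity asks
    that the iterates stay on one side of [x]. If [S(x) <> 0], the sign of [S]
    near [x] decides the side. If [S(x) = 0], it is crucial that [S] increases
    through [x] ([pull_increase]): then [S(lam)] has the sign of [t], so [L]
    maps each side of [x] into itself instead of exchanging the two sides. *)

(** * Solutions of the eigenvalue recurrence *)

Definition pairing (K : pzRingType) (n : nat) (pi x y : nat -> K) : K :=
  \sum_(1 <= k < n.+1) pi k * x k * y k.

(** This is [pi k] times the [k]-th coordinate of [lam x - M x] for a path cut
    after vertex [k], that is, without the edge from [k] to [k+1]. *)
Definition residual (K : pzRingType) (pi nu : nat -> K) (lam : K)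
    (x : nat -> K) (k : nat) : K :=
  lam * pi k * x k - nu k.-1 * (x k - x k.-1).

(** The eigenvalue equation at the vertices [1, ..., n-1], as satisfied by [xi].
    It is free of divisions so that it makes sense in any ring and is preserved
    by ring morphisms: below it is used over the reals, the complex numbers and
    the polynomials. *)
Definition shoots (K : pzRingType) (n : nat) (pi nu : nat -> K) (lam : K)
    (x : nat -> K) : Prop :=
  forall k, (1 <= k < n)%N -> nu k * (x k.+1 - x k) = - residual pi nu lam x k.

Lemma shoots_le (K : pzRingType) n m (pi nu : nat -> K) lam x :
  (m <= n)%N -> shoots n pi nu lam x -> shoots m pi nu lam x.
Proof.
move=> lemn xP k /andP[k1 km]; apply: xP.
by rewrite k1 (leq_trans km).
Qed.

(** The two products of residuals telescope: at an inner vertex both are given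
    by the flux [nu k * (x k.+1 - x k)] through the edge to the right. *)
Lemma christoffel_darboux (K : comPzRingType) n (pi nu : nat -> K) lam mu x y :
    nu 0 = 0 -> (1 <= n)%N ->
    shoots n pi nu lam x -> shoots n pi nu mu y ->
  (lam - mu) * pairing n pi x y =
    residual pi nu lam x n * y n - x n * residual pi nu mu y n.
Proof.
move=> nu0; elim: n => // -[_ _ _ _|n IHn _ xP yP].
  by rewrite /pairing big_nat1 /residual /= nu0; ring.
have IH := IHn isT (shoots_le (leqnSn _) xP) (shoots_le (leqnSn _) yP).
rewrite /pairing big_nat_recr //= mulrDr -/(pairing n.+1 pi x y) {}IH.
have /eqP := xP n.+1 (ltnSn _); rewrite -eqr_oppLR => /eqP<-.
have /eqP := yP n.+1 (ltnSn _); rewrite -eqr_oppLR => /eqP<-.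
by rewrite /residual /=; ring.
Qed.

(** The discrete Green formula; the residual is the boundary term. *)
Lemma shoots_energy (K : comPzRingType) n (pi nu : nat -> K) lam x :
    nu 0 = 0 -> (1 <= n)%N -> shoots n pi nu lam x ->
  \sum_(1 <= k < n) (x k - x k.+1) ^+ 2 * nu k =
    lam * pairing n pi x x - residual pi nu lam x n * x n.
Proof.
move=> nu0; elim: n => // -[_ _ _|n IHn _ xP].
  by rewrite /pairing big_nat1 big_geq // /residual /= nu0; ring.
rewrite big_nat_recr //= (IHn isT (shoots_le (leqnSn _) xP)).
rewrite /pairing [in RHS]big_nat_recr //=.
have /eqP := xP n.+1 (ltnSn _); rewrite -eqr_oppLR => /eqP<-.
by rewrite /residual /=; ring.
Qed.

Lemma shoots_const (K : pzRingType) n (pi nu : nat -> K) (c : K) :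
  shoots n pi nu 0 (fun=> c).
Proof. by move=> k _; rewrite /residual !subrr !mulr0 !mul0r subrr oppr0. Qed.

(** The polynomial in [lam] whose value is [xi] (see [horner_xi_poly]). *)
Fixpoint xi_poly (R : fieldType) (pi nu : nat -> R) (v : nat) : {poly R} :=
  if v is k.+1 then
    if k is j.+1 then
      xi_poly pi nu k
      + (nu k)^-1 *: (nu j *: (xi_poly pi nu k - xi_poly pi nu j)
                      - pi k *: ('X * xi_poly pi nu k))
    else -1
  else 0.

Lemma shoots_rmorph (K L : pzRingType) (f : {rmorphism K -> L}) n
    (pi nu : nat -> K) lam x :
  shoots n pi nu lam x -> shoots n (f \o pi) (f \o nu) (f lam) (f \o x).
Proof.
by move=> xP k /xP /(congr1 f); rewrite /residual !(rmorphN, rmorphM, rmorphB).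
Qed.

Lemma residual_rmorph (K L : pzRingType) (f : {rmorphism K -> L})
    (pi nu : nat -> K) lam x k :
  residual (f \o pi) (f \o nu) (f lam) (f \o x) k = f (residual pi nu lam x k).
Proof. by rewrite /residual !(rmorphM, rmorphB). Qed.

Definition residual_poly (R : fieldType) (pi nu : nat -> R) (k : nat) : {poly R} :=
  residual (polyC \o pi) (polyC \o nu) 'X (xi_poly pi nu) k.

Lemma xi_polyS (R : fieldType) (pi nu : nat -> R) k : (0 < k)%N ->
  xi_poly pi nu k.+1 = xi_poly pi nu k - (nu k)^-1 *: residual_poly pi nu k.
Proof.
case: k => // k _; set u := xi_poly pi nu k.+1; set v := xi_poly pi nu k.
transitivity (u + (nu k.+1)^-1 *: (nu k *: (u - v) - pi k.+1 *: ('X * u))) => //.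
by rewrite /residual_poly /residual -/u -/v -!mul_polyC /=; ring.
Qed.

Lemma horner_xi_poly (R : realType) (pi nu : nat -> R) lam v :
  (xi_poly pi nu v).[lam] = xi pi nu lam v.
Proof.
elim/ltn_ind: v => -[|[|v]] IHv.
- by rewrite horner0.
- by rewrite hornerN hornerC.
rewrite xi_polyS // /residual_poly /residual !hornerE !IHv //.
set u := xi pi nu lam v.+1; set w := xi pi nu lam v.
transitivity (u + ((u - w) * nu v - lam * pi v.+1 * u) / nu v.+1) => //=.
by ring.
Qed.

Lemma xi_poly_shoots (R : fieldType) n (pi nu : nat -> R) :
    (forall k, (1 <= k < n)%N -> nu k != 0) ->
  shoots n (polyC \o pi) (polyC \o nu) 'X (xi_poly pi nu).
Proof.
move=> nuP k /andP[k0 kn]; rewrite xi_polyS // addrAC subrr add0r.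
by rewrite mulrN /= -scalerAr mul_polyC scalerA mulVf ?scale1r ?nuP ?k0.
Qed.

(** The degree grows by one per vertex since only [lam * pi k * x k] raises it. *)
Lemma size_residual_poly (R : fieldType) n (pi nu : nat -> R) k :
    (forall j, (1 <= j <= n)%N -> pi j != 0) ->
    (forall j, (1 <= j < n)%N -> nu j != 0) ->
  (k < n)%N ->
  size (xi_poly pi nu k.+1) = k.+1 /\ size (residual_poly pi nu k.+1) = k.+2.
Proof.
move=> piP nuP.
have resP j : (j < n)%N -> size (xi_poly pi nu j.+1) = j.+1 ->
    (size (xi_poly pi nu j) <= j.+1)%N ->
    size (residual_poly pi nu j.+1) = j.+2.
  move=> jn sz1 sz0; have nz : xi_poly pi nu j.+1 != 0 by rewrite -size_poly_eq0 sz1.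
  have sz2 : size ('X * (pi j.+1)%:P * xi_poly pi nu j.+1) = j.+2.
    by rewrite mulrAC mulrC mul_polyC size_scale ?piP // mulrC size_mulX ?sz1.
  rewrite /residual_poly /residual /= size_polyDl sz2 // size_polyN ltnS.
  rewrite mul_polyC (leq_trans (size_scale_leq _ _)) //.
  by rewrite (leq_trans (size_polyD _ _)) // size_polyN geq_max sz1 leqnn.
elim: k => [|k IHk] kn.
  have sz : size (xi_poly pi nu 1) = 1%N by rewrite /= size_polyN size_poly1.
  by split=> //; apply: resP; rewrite // /= size_poly0.
have [sz1 sz2] := IHk (ltnW kn).
have sz : size (xi_poly pi nu k.+2) = k.+2.
  rewrite xi_polyS // addrC size_polyDl size_polyN size_scale ?invr_eq0 ?nuP //.
  by rewrite sz2 sz1.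
by split=> //; apply: resP; rewrite // sz1.
Qed.

Lemma pairing_gt0 (K : numDomainType) n (pi x y : nat -> K) :
    (forall k, (1 <= k <= n)%N -> 0 < pi k) ->
    (forall k, 0 <= x k * y k) -> (1 <= n)%N -> x 1%N * y 1%N != 0 ->
  0 < pairing n pi x y.
Proof.
move=> piP xyP n1 xy1; rewrite /pairing big_ltn // ltr_pwDl //.
  by rewrite -mulrA mulr_gt0 ?piP // lt_def xy1 xyP.
rewrite big_nat_cond sumr_ge0 // => k; rewrite andbT => /andP[k1 kn].
by rewrite -mulrA mulr_ge0 ?xyP // ltW // piP // (ltnW k1).
Qed.

Section Evaluation.
Variables (R : fieldType) (L : comNzRingType) (iota : {rmorphism R -> L}).
Variables (n : nat) (pi nu : nat -> R) (z : L).

Definition xi_at (k : nat) : L := (map_poly iota (xi_poly pi nu k)).[z].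

Let ev : {rmorphism {poly R} -> L} := horner_eval z \o map_poly iota.

Let ev_polyC (f : nat -> R) : ev \o (polyC \o f) = iota \o f.
Proof. by apply/funext => k; rewrite /= map_polyC /horner_eval hornerC. Qed.

Let ev_polyX : ev 'X = z.
Proof. by rewrite /= map_polyX /horner_eval hornerX. Qed.

Lemma shoots_at : (forall k, (1 <= k < n)%N -> nu k != 0) ->
  shoots n (iota \o pi) (iota \o nu) z xi_at.
Proof.
move=> nuP; have := shoots_rmorph ev (xi_poly_shoots pi nuP).
by rewrite !ev_polyC ev_polyX.
Qed.

Lemma residual_at k :
  residual (iota \o pi) (iota \o nu) z xi_at k =
    (map_poly iota (residual_poly pi nu k)).[z].
Proof.
have := residual_rmorph ev (polyC \o pi) (polyC \o nu) 'X (xi_poly pi nu) k.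
by rewrite !ev_polyC ev_polyX.
Qed.
End Evaluation.

Lemma xi_at_idfun (R : realType) (pi nu : nat -> R) lam :
  xi_at idfun pi nu lam = xi pi nu lam.
Proof.
by apply/funext => k; rewrite /xi_at map_poly_id // horner_xi_poly.
Qed.

(** * The spectrum of the path *)

Section Spectrum.
Variables (R : realType) (n : nat) (pi nu : nat -> R).
Hypothesis n_ge1 : (1 <= n)%N.
Hypothesis path : weighted_path n pi nu.

Local Notation F := (residual_poly pi nu n).

Let nu_neq0 k : (1 <= k < n)%N -> nu k != 0.
Proof. by move/(edge_gt0 path)/lt0r_neq0. Qed.

Let pi_neq0 k : (1 <= k <= n)%N -> pi k != 0.
Proof. by move/(vertex_gt0 path)/lt0r_neq0. Qed.

Lemma xi_shoots lam : shoots n pi nu lam (xi pi nu lam).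
Proof. by have := shoots_at idfun pi lam nu_neq0; rewrite xi_at_idfun. Qed.

Lemma residual_xi lam k :
  residual pi nu lam (xi pi nu lam) k = (residual_poly pi nu k).[lam].
Proof.
by have := residual_at idfun pi nu lam k; rewrite xi_at_idfun map_poly_id.
Qed.

(** If [z] is a root then so is its conjugate, and the Christoffel-Darboux
    identity for this pair reads [(z - z^* ) * <x_z, conj x_z> = 0]. *)
Lemma residual_root_complex_real (z : R[i]%C) :
  root (map_poly (real_complex R) F) z -> z \is Num.real.
Proof.
move=> Fz; pose iota : {rmorphism R -> R[i]%C} := real_complex R.
have conj_at p : (map_poly iota p).[z^*] = ((map_poly iota p).[z])^*.
  rewrite -horner_map -map_poly_comp; congr (_.[_]).
  by apply: eq_map_poly => a; exact/esym/conjc_real.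
have := christoffel_darboux (congr1 iota (edge_left0 path)) n_ge1
  (shoots_at iota pi z nu_neq0) (shoots_at iota pi z^* nu_neq0).
rewrite !residual_at conj_at (rootP Fz) conjC0 mulr0 mul0r subrr => /eqP.
rewrite mulf_eq0 subr_eq0 eq_sym -CrealE => /orP[//|].
rewrite gt_eqF // pairing_gt0 //.
- by move=> k kP; rewrite /= ltcR (vertex_gt0 path).
- by move=> k; rewrite /xi_at conj_at mul_conjC_ge0.
- by rewrite /xi_at conj_at mul_conjC_eq0 rmorphN1 hornerN hornerC oppr_eq0 oner_eq0.
Qed.

Lemma pairing_xi_gt0 lam : 0 < pairing n pi (xi pi nu lam) (xi pi nu lam).
Proof.
rewrite pairing_gt0 //; first exact: vertex_gt0 path.
  by move=> k; rewrite -expr2 sqr_ge0.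
by rewrite mulrNN mulr1 oner_eq0.
Qed.

(** The Christoffel-Darboux identity between the indeterminate ['X] and the
    root [a], divided by ['X - a] and evaluated at [a]. As the left-hand side is
    positive, the root [a] is simple and [xi a] does not vanish at the end. *)
Lemma pairing_xi_cofactor a G : F = ('X - a%:P) * G ->
  pairing n pi (xi pi nu a) (xi pi nu a) = G.[a] * xi pi nu a n.
Proof.
move=> FE; have Fa : F.[a] = 0 by rewrite FE !hornerE subrr mul0r.
have := christoffel_darboux (congr1 polyC (edge_left0 path)) n_ge1
  (xi_poly_shoots pi nu_neq0) (shoots_rmorph polyC (xi_shoots a)).
rewrite residual_rmorph residual_xi Fa mulr0 subr0 -/F FE -mulrA.
move/(mulfI (negbT (polyXsubC_eq0 a))) => /(congr1 (horner^~ a)).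
rewrite !hornerE => <-; rewrite /pairing horner_sum; apply: eq_bigr => k _.
by rewrite !hornerE horner_xi_poly.
Qed.

Lemma residual_roots_exist :
  exists s : seq R, [/\ uniq s, size s = n & all (root F) s].
Proof.
have [szF] : size F = n.+1.
  have := @size_residual_poly _ n pi nu n.-1 pi_neq0 nu_neq0.
  by rewrite prednK // => /(_ (leqnn n)) [].
have F_neq0 : F != 0 by rewrite -size_poly_eq0 szF.
pose iota : {rmorphism R -> R[i]%C} := real_complex R.
have [r Fr] := closed_field_poly_normal (map_poly iota F).
have lF : lead_coef (map_poly iota F) != 0 by rewrite lead_coef_eq0 map_poly_eq0.
have r_real z : z \in r -> ((complex.Re z)%:C)%C = z.
  move=> zr; apply/RRe_real/residual_root_complex_real.
  by rewrite Fr rootZ // root_prod_XsubC.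
pose s := map (@complex.Re R) r.
have FE : F = lead_coef F *: \prod_(a <- s) ('X - a%:P).
  apply: (map_inj_poly (f := iota)) => //; first exact: complexI.
  rewrite map_polyZ rmorph_prod [LHS]Fr lead_coef_map; congr (_ *: _).
  rewrite big_map; apply: eq_big_seq => z zr.
  by rewrite rmorphB /= map_polyX map_polyC /= r_real.
have F_root a : a \in s -> root F a.
  by move=> sa; rewrite FE rootZ ?root_prod_XsubC // lead_coef_eq0.
exists s; split; last exact/allP.
(* A repeated root would make the cofactor of [pairing_xi_cofactor] vanish. *)
- apply: count_mem_uniq => a; case: (boolP (a \in s)) => [sa|/count_memPn//].
  have := perm_to_rem sa => /permP->; rewrite /= eqxx; congr (_.+1).
  apply/count_memPn; apply/negP => ra.
  have /pairing_xi_cofactor :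
      F = ('X - a%:P) * (lead_coef F *: \prod_(b <- rem a s) ('X - b%:P)).
    by rewrite -scalerAr [LHS]FE (big_rem _ sa).
  have /rootP-> : root (lead_coef F *: \prod_(b <- rem a s) ('X - b%:P)) a.
    by rewrite rootZ ?lead_coef_eq0 // root_prod_XsubC.
  by move/eqP; rewrite mul0r gt_eqF // pairing_xi_gt0.
- have := szF; rewrite [in LHS]FE size_scale ?lead_coef_eq0 //.
  by rewrite size_prod_XsubC => -[].
Qed.

(** The product [pi v * M v w] involves the edge weights only and is symmetric
    in [v] and [w]; this is why [pi * xi] is a left eigenvector. *)
Lemma path_entryE v w x : (1 <= v <= n)%N -> (1 <= w)%N ->
  pi v * x * path_entry pi nu v w =
    (if v == w then x * (nu v.-1 + nu v) else 0)
    - (if v == w.-1 then x * nu v else 0) - (if v == w.+1 then x * nu w else 0).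
Proof.
move=> vP w1; have piv := pi_neq0 vP; rewrite /path_entry.
have cancel y : pi v * x * (y / pi v) = x * y by field.
have -> : (w == v.+1) = (v == w.-1) by case: w w1 => // w _; rewrite eqSS eq_sym.
have [vw|nvw] := eqVneq v w.
  rewrite cancel vw; case: w w1 {vw} => // w _.
  by rewrite !eqn_leq !ltnn ?andbF /= !subr0.
have [vw|_] /= := eqVneq v w.-1.
  rewrite cancel vw; case: w w1 {nvw vw} => // w _ /=.
  by rewrite (minn_idPl _) //= (ltn_eqF (leqnSn w.+1)); ring.
case: eqVneq => [vw|_]; last by rewrite mulr0 !subr0.
by rewrite cancel vw (minn_idPr _) //; ring.
Qed.

Lemma residual_root_eigenvalue a :
  root F a -> root (char_poly (path_matrix n pi nu)) a.
Proof.
move=> Fa; rewrite -eigenvalue_root_char; apply/eigenvalueP.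
pose u := xi pi nu a.
exists (\row_(k < n) (pi k.+1 * u k.+1)).
  apply/rowP => j; rewrite !mxE.
  have resE : residual pi nu a u j.+1 = - (nu j.+1 * (u j.+2 - u j.+1)).
    have [jn|nj] := ltnP j.+1 n; first by rewrite (xi_shoots a) ?opprK.
    have -> : j.+1 = n by apply/eqP; rewrite eqn_leq nj ltn_ord.
    by rewrite residual_xi (rootP Fa) (edge_right0 path) mul0r oppr0.
  under eq_bigr do rewrite !mxE.
  pose G v := pi v * u v * path_entry pi nu v j.+1.
  rewrite -(big_mkord xpredT (fun k => G k.+1)) -(big_add1 _ _ 0 n.+1 xpredT G).
  rewrite big_nat (eq_bigr _ (fun v vP => path_entryE _ vP (ltn0Sn _))) -big_nat.
  rewrite !sumrB -!big_mkcond /= !big_nat1_eq !ltnS (ltn_ord j) !andTb [j.+1.-1]/=.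
  rewrite (ltnW (ltn_ord j)) andbT.
  (* The neighbours [0] and [n.+1] are absent from the sum, but their terms
     carry the boundary weights [nu 0] and [nu n], which vanish. *)
  have -> : (if (0 < j)%N then u j * nu j else 0) = u j * nu j.
    by case: posnP => // ->; rewrite (edge_left0 path) mulr0.
  have -> : (if (j.+1 < n)%N then u j.+2 * nu j.+1 else 0) = u j.+2 * nu j.+1.
    case: ltnP => // nj; have -> : j.+1 = n by apply/eqP; rewrite eqn_leq nj ltn_ord.
    by rewrite (edge_right0 path) mulr0.
  have -> : a * (pi j.+1 * u j.+1) = residual pi nu a u j.+1 + nu j * (u j.+1 - u j).
    by rewrite /residual [j.+1.-1]/=; ring.
  by rewrite resE; ring.
apply/eqP => /rowP/(_ (Ordinal n_ge1)); rewrite !mxE => /eqP.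
by rewrite mulrN1 oppr_eq0 (negbTE (pi_neq0 _)).
Qed.

Local Notation spectrum := (rootsR (char_poly (path_matrix n pi nu))).

Lemma spectrumP : [/\ sorted <%R spectrum, size spectrum = n &
  forall mu, (mu \in spectrum) = root F mu].
Proof.
have cp0 : char_poly (path_matrix n pi nu) != 0 by rewrite monic_neq0 ?char_poly_monic.
have [s [s_uniq s_size /allP s_root]] := residual_roots_exist.
have s_sub : {subset s <= spectrum}.
  move=> a /s_root/residual_root_eigenvalue ra.
  by rewrite -(roots_on_rootsR cp0) ra andbT in_itv.
have srt : sorted <%R spectrum by apply: sorted_roots.
have le : (size spectrum <= size s)%N.
  rewrite s_size -ltnS -(size_char_poly (path_matrix n pi nu)).
  apply: max_poly_roots => //; last exact: lt_sorted_uniq.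
  by apply/allP => x; apply: root_roots.
have [sz mem] := uniq_min_size s_uniq s_sub le.
split=> // [|mu]; first by rewrite -sz.
rewrite -mem; apply/idP/idP => [/s_root//|Fmu].
by rewrite mem -(roots_on_rootsR cp0) residual_root_eigenvalue // in_itv.
Qed.

(** Christoffel-Darboux against the constant function, which solves the
    recurrence with parameter [0]. *)
Lemma residual_mean lam : F.[lam] = lam * mean n pi (xi pi nu lam).
Proof.
have := christoffel_darboux (edge_left0 path) n_ge1 (xi_shoots lam)
  (shoots_const (n := n) pi nu 1).
rewrite residual_xi subr0 mulr1 /residual subrr mulr0 !mul0r subrr mulr0 subr0.
move=> <-; congr (_ * _); rewrite /mean /pairing; apply: eq_bigr => k _.
by rewrite mulr1 mulrC.
Qed.

Lemma dirichlet_xi lam : dirichlet n nu (xi pi nu lam) =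
  lam * pairing n pi (xi pi nu lam) (xi pi nu lam) - F.[lam] * xi pi nu lam n.
Proof.
by rewrite -residual_xi; apply: shoots_energy (edge_left0 path) n_ge1 (xi_shoots lam).
Qed.

Lemma spectrum_ge0 mu : mu \in spectrum -> 0 <= mu.
Proof.
have [_ _ ->] := spectrumP => Fmu.
rewrite -(pmulr_lge0 _ (pairing_xi_gt0 mu)).
have := dirichlet_xi mu; rewrite (rootP Fmu) mul0r subr0 => <-.
rewrite /dirichlet big_nat_cond sumr_ge0 // => k; rewrite andbT => kP.
by rewrite mulr_ge0 ?sqr_ge0 // ltW // (edge_gt0 path).
Qed.

Lemma spectrum0 : 0 \in spectrum.
Proof. by have [_ _ ->] := spectrumP; rewrite rootE residual_mean mul0r. Qed.

Lemma path_eigenvalue_gt0 i : (1 <= i < n)%N ->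
  path_eigenvalue n pi nu i \in spectrum /\ 0 < path_eigenvalue n pi nu i.
Proof.
have [srt sz _] := spectrumP => /andP[i1 iN].
have n0 : (0 < n)%N by [].
have mem k : (k < n)%N -> spectrum`_k \in spectrum by move=> kn; rewrite mem_nth ?sz.
split; first exact: mem.
apply: (le_lt_trans (spectrum_ge0 (mem _ n0))).
by rewrite /path_eigenvalue lt_sorted_ltn_nth ?inE ?sz.
Qed.

Lemma xi_orthogonal lam mu : root F mu ->
  (lam - mu) * pairing n pi (xi pi nu lam) (xi pi nu mu) = F.[lam] * xi pi nu mu n.
Proof.
move=> Fmu; have nu0 := edge_left0 path.
rewrite (christoffel_darboux nu0 n_ge1 (xi_shoots lam) (xi_shoots mu)).
by rewrite !residual_xi (rootP Fmu) mulr0 subr0.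
Qed.

Lemma xi_end_neq0 mu : root F mu -> xi pi nu mu n != 0.
Proof.
case/factor_theorem => G; rewrite mulrC => /pairing_xi_cofactor E.
by apply: contraTneq (pairing_xi_gt0 mu) => E0; rewrite E E0 mulr0 ltxx.
Qed.

Lemma xi0E k : xi pi nu 0 k.+1 = -1.
Proof.
elim/ltn_ind: k => -[//|k] IHk.
transitivity (xi pi nu 0 k.+1 + ((xi pi nu 0 k.+1 - xi pi nu 0 k) * nu k
  - 0 * pi k.+1 * xi pi nu 0 k.+1) / nu k.+1) => //.
rewrite mul0r mul0r subr0 IHk //; case: k IHk => [|k] IHk.
  by rewrite (edge_left0 path) mulr0 mul0r addr0.
by rewrite IHk // subrr !mul0r addr0.
Qed.

(** The [n] functions [xi mu] are orthogonal, hence a basis: the matrix that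
    they form has a one-sided, hence two-sided, inverse. *)
Lemma xi_expansion f k : (1 <= k <= n)%N ->
  f k = \sum_(mu <- spectrum) pairing n pi f (xi pi nu mu)
          / pairing n pi (xi pi nu mu) (xi pi nu mu) * xi pi nu mu k.
Proof.
case: k => // k /andP[_ kn]; have [srt sz rt] := spectrumP.
pose d mu := pairing n pi (xi pi nu mu) (xi pi nu mu).
pose A : 'M[R]_n := \matrix_(j, l) xi pi nu spectrum`_j l.+1.
pose B : 'M[R]_n := \matrix_(j, l) (pi l.+1 * A j l / d spectrum`_j).
have mkord x y : pairing n pi x y = \sum_(l < n) pi l.+1 * x l.+1 * y l.+1.
  by rewrite /pairing big_add1 big_mkord.
have /mulmx1C BA : B *m A^T = 1%:M.
  apply/matrixP => i j; rewrite !mxE.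
  transitivity ((d spectrum`_i)^-1 *
      pairing n pi (xi pi nu spectrum`_i) (xi pi nu spectrum`_j)).
    by rewrite mkord mulr_sumr; apply: eq_bigr => l _; rewrite !mxE; ring.
  have [<-|ij] := eqVneq i j; first by rewrite mulVf ?mulr1n // gt_eqF ?pairing_xi_gt0.
  have neq : spectrum`_i - spectrum`_j != 0.
    by rewrite subr_eq0 nth_uniq ?sz ?ltn_ord // lt_sorted_uniq.
  have rtj l : root F spectrum`_(l : 'I_n) by rewrite -rt mem_nth ?sz.
  have /eqP := xi_orthogonal spectrum`_i (rtj j).
  by rewrite (rootP (rtj i)) mul0r mulf_eq0 (negbTE neq) => /eqP->; rewrite mulr0.
transitivity (\sum_(l < n) f l.+1 * (A^T *m B) (Ordinal kn) l).
  rewrite BA (bigD1 (Ordinal kn)) //= mxE eqxx mulr1 big1 ?addr0 // => l /negbTE lk.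
  by rewrite mxE eq_sym lk mulr0.
transitivity (\sum_(l < n) \sum_(j < n) f l.+1 * (A^T (Ordinal kn) j * B j l)).
  by apply: eq_bigr => l _; rewrite mxE mulr_sumr.
rewrite exchange_big (big_nth 0) big_mkord sz; apply: eq_bigr => j _.
rewrite mkord -/(d _) !mulr_suml; apply: eq_bigr => l _.
by rewrite !mxE [nat_of_ord (Ordinal kn)]/=; ring.
Qed.

(** The squared norm of the projection of [xi lam] on the eigenvector [xi mu]. *)
Definition spectral_mass lam mu : R :=
  pairing n pi (xi pi nu lam) (xi pi nu mu) ^+ 2
  / pairing n pi (xi pi nu mu) (xi pi nu mu).

Lemma pairing_xi_parseval lam :
  pairing n pi (xi pi nu lam) (xi pi nu lam) =
    \sum_(mu <- spectrum) spectral_mass lam mu.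
Proof.
rewrite {1}/pairing big_nat.
under eq_bigr => k kP do rewrite {2}(xi_expansion (xi pi nu lam) kP) mulr_sumr.
rewrite -big_nat exchange_big; apply: eq_bigr => mu _ /=.
rewrite /spectral_mass expr2 -mulrA [RHS]mulr_suml; apply: eq_bigr => k _; ring.
Qed.

(** Subtracting the squared mean removes the component along the constants,
    the eigenvectors of [0]. *)
Lemma variance_xi lam :
  Defs.variance n pi (xi pi nu lam) =
    \sum_(mu <- spectrum | mu != 0) spectral_mass lam mu.
Proof.
have [srt _ _] := spectrumP; have uniq := lt_sorted_uniq srt.
have -> : Defs.variance n pi (xi pi nu lam) =
    pairing n pi (xi pi nu lam) (xi pi nu lam) - spectral_mass lam 0.
  congr (_ - _); first by apply: eq_bigr => k _; ring.
  have meanE x : pairing n pi x (xi pi nu 0) = - mean n pi x.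
    rewrite -sumrN; apply: eq_big_nat => -[//|k] _.
    by rewrite xi0E; ring.
  rewrite /spectral_mass !meanE sqrrN.
  have -> : mean n pi (xi pi nu 0) = -1.
    rewrite -(vertex_sum1 path) -sumrN; apply: eq_big_nat => -[//|k] _.
    by rewrite xi0E mulN1r.
  by rewrite opprK divr1.
by rewrite pairing_xi_parseval (bigD1_seq 0) ?spectrum0 //= addrAC subrr add0r.
Qed.

Lemma dirichlet_xi_spectral lam :
  dirichlet n nu (xi pi nu lam) =
    \sum_(mu <- spectrum | mu != 0) mu * spectral_mass lam mu.
Proof.
have [srt _ rt] := spectrumP; have uniq := lt_sorted_uniq srt.
transitivity (\sum_(mu <- spectrum) mu * spectral_mass lam mu); last first.
  by rewrite (bigD1_seq 0) ?spectrum0 //= mul0r add0r.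
rewrite dirichlet_xi pairing_xi_parseval mulr_sumr.
rewrite (xi_expansion (xi pi nu lam) (k := n)) ?n_ge1 ?leqnn // mulr_sumr -sumrB.
apply: eq_big_seq => mu; rewrite rt => Fmu.
rewrite [F.[lam] * _]mulrC -[_ * _ * F.[lam]]mulrA [_ * F.[lam]]mulrC.
by rewrite -xi_orthogonal // /spectral_mass; ring.
Qed.

Definition end_weight mu : R :=
  xi pi nu mu n ^+ 2 / pairing n pi (xi pi nu mu) (xi pi nu mu).

Lemma end_weight_gt0 mu : mu \in spectrum -> 0 < end_weight mu.
Proof.
have [_ _ ->] := spectrumP => /xi_end_neq0 xn.
by rewrite divr_gt0 ?pairing_xi_gt0 // exprn_even_gt0.
Qed.

(** The factor [F.[lam] ^+ 2] does not depend on [mu] and cancels in the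
    Rayleigh quotient. *)
Lemma spectral_massE lam mu : mu \in spectrum -> lam != mu ->
  spectral_mass lam mu = F.[lam] ^+ 2 * (end_weight mu / (lam - mu) ^+ 2).
Proof.
have [_ _ ->] := spectrumP => Fmu; rewrite -subr_eq0 => neq.
have d0 : pairing n pi (xi pi nu mu) (xi pi nu mu) != 0.
  by rewrite gt_eqF ?pairing_xi_gt0.
have E := xi_orthogonal lam Fmu.
have -> : F.[lam] ^+ 2 * (end_weight mu / (lam - mu) ^+ 2) =
    (F.[lam] * xi pi nu mu n) ^+ 2 /
      (pairing n pi (xi pi nu mu) (xi pi nu mu) * (lam - mu) ^+ 2).
  by rewrite /end_weight; field; rewrite neq d0.
by rewrite -E /spectral_mass; field; rewrite neq d0.
Qed.

Lemma rayleigh_fixed x : x \in spectrum -> 0 < x -> rayleigh n pi nu x = x.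
Proof.
have [srt _ rt] := spectrumP; have uniq := lt_sorted_uniq srt.
move=> xs x0; have Fx : F.[x] = 0 by apply/rootP; rewrite -rt.
have m0 : mean n pi (xi pi nu x) = 0.
  by apply/eqP; have /eqP := residual_mean x; rewrite Fx eq_sym mulf_eq0 gt_eqF.
rewrite /rayleigh dirichlet_xi Fx mul0r subr0 /Defs.variance m0 expr0n subr0.
have -> : mean n pi (fun i => xi pi nu x i ^+ 2) =
    pairing n pi (xi pi nu x) (xi pi nu x).
  by apply: eq_bigr => k _; ring.
by rewrite mulfK // gt_eqF ?pairing_xi_gt0.
Qed.

(** The function [S] whose sign says on which side of [x] the Rayleigh quotient
    falls. *)
Definition pull (R : fieldType) (r : seq R) (w : R -> R) (x lam : R) : R :=
  \sum_(mu <- r) (mu - x) * w mu / (lam - mu) ^+ 2.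

(** Numerator and denominator are multiplied by [(lam - x) ^+ 2 / F.[lam] ^+ 2],
    so that no singularity is left at [lam = x]. *)
Lemma rayleigh_displacement x lam (r := [seq mu <- spectrum | mu != 0 & mu != x]) :
    x \in spectrum -> 0 < x -> lam \notin spectrum ->
  rayleigh n pi nu lam - x =
    (lam - x) ^+ 2 * pull r end_weight x lam
    / (end_weight x + (lam - x) ^+ 2 * \sum_(mu <- r) end_weight mu / (lam - mu) ^+ 2).
Proof.
have [srt _ rt] := spectrumP; have uniq := lt_sorted_uniq srt.
move=> xs x0 lams.
have lam_neq mu : mu \in spectrum -> lam != mu.
  by apply: contraTneq => <-.
have t0 : lam - x != 0 by rewrite subr_eq0 lam_neq.
have F0 : F.[lam] != 0 by rewrite -rootE -rt.
have split_x (G : R -> R) :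
    \sum_(mu <- spectrum | mu != 0) G mu = G x + \sum_(mu <- r) G mu.
  rewrite -big_filter (bigD1_seq x) ?filter_uniq ?mem_filter ?gt_eqF //=.
  rewrite -big_filter -filter_predI; congr (_ + \sum_(i <- _) _).
  by apply: eq_filter => mu /=; rewrite andbC.
have rE (c : R -> R) : \sum_(mu <- r) c mu * spectral_mass lam mu =
    F.[lam] ^+ 2 * \sum_(mu <- r) c mu * end_weight mu / (lam - mu) ^+ 2.
  rewrite mulr_sumr; apply: eq_big_seq => mu; rewrite mem_filter => /andP[_ mus].
  by rewrite spectral_massE ?lam_neq //; ring.
have VE : Defs.variance n pi (xi pi nu lam) = F.[lam] ^+ 2 / (lam - x) ^+ 2 *
    (end_weight x + (lam - x) ^+ 2 * \sum_(mu <- r) end_weight mu / (lam - mu) ^+ 2).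
  rewrite variance_xi split_x spectral_massE ?lam_neq //.
  have -> : \sum_(mu <- r) spectral_mass lam mu =
      F.[lam] ^+ 2 * \sum_(mu <- r) end_weight mu / (lam - mu) ^+ 2.
    rewrite mulr_sumr; apply: eq_big_seq => mu; rewrite mem_filter => /andP[_ mus].
    by rewrite spectral_massE ?lam_neq.
  by field.
have den_gt0 : 0 < end_weight x +
    (lam - x) ^+ 2 * \sum_(mu <- r) end_weight mu / (lam - mu) ^+ 2.
  rewrite ltr_pwDl ?end_weight_gt0 // mulr_ge0 ?sqr_ge0 // big_seq sumr_ge0 // => mu.
  rewrite mem_filter => /andP[_ mus].
  by rewrite divr_ge0 ?sqr_ge0 // ltW ?end_weight_gt0.
have V0 : Defs.variance n pi (xi pi nu lam) != 0.
  by rewrite VE mulf_neq0 ?(gt_eqF den_gt0) // mulf_neq0 ?invr_eq0 ?expf_neq0.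
have -> : rayleigh n pi nu lam - x =
    (\sum_(mu <- r) (mu - x) * spectral_mass lam mu)
    / Defs.variance n pi (xi pi nu lam).
  rewrite /rayleigh -[x in LHS](mulfK V0) -mulrBl; congr (_ / _).
  rewrite dirichlet_xi_spectral variance_xi mulr_sumr -sumrB split_x subrr add0r.
  by apply: eq_bigr => mu _; rewrite mulrBl.
rewrite rE VE /pull; field.
by rewrite t0 F0 gt_eqF.
Qed.

End Spectrum.

(** * Iteration near a quadratically attracting fixed point *)

Lemma iterates_cvg (R : realType) (L : R -> R) (x eps : R) (a : R) :
    (forall lam, `|lam - x| < eps -> `|L lam - x| <= `|lam - x| / 2) ->
    `|a - x| < eps ->
  (forall l, `|iter l L a - x| < eps) /\ (fun l => iter l L a) @ \oo --> x.
Proof.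
move=> LP aP.
have near l : `|iter l L a - x| < eps.
  elim: l => // l IHl; rewrite (le_lt_trans (LP _ IHl)) //.
  by have := normr_ge0 (iter l L a - x); lra.
split=> //; have bound l : `|iter l L a - x| <= geometric `|a - x| 2^-1 l.
  elim: l => [|l IHl]; first by rewrite /= expr0 mulr1.
  rewrite (le_trans (LP _ (near l))) // /= exprSr mulrA ler_pM2r ?invr_gt0 //.
have geo : geometric `|a - x| 2^-1 @ \oo --> (0 : R).
  by apply: cvg_geometric; rewrite gtr0_norm ?invr_gt0 // invf_lt1 // ltr1n.
apply/subr_cvg0/norm_cvg0P; apply: (squeeze_cvgr _ (@cvg_cst _ (0 : R) _ _ _) geo).
by near=> l; rewrite normr_ge0 bound.
Unshelve. all: by end_near.
Qed.

(** The iterates approach [x], so it is enough that they stay on one side. In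
    the third case [L] preserves both sides, and the side is that of [a]. *)
Lemma iterates_monotone (R : realType) (L : R -> R) (x eps a : R) :
    (forall lam, `|lam - x| < eps -> `|L lam - x| <= `|lam - x| / 2) ->
    [\/ forall lam, `|lam - x| < eps -> x <= L lam,
        forall lam, `|lam - x| < eps -> L lam <= x |
        forall lam, `|lam - x| < eps -> 0 <= (L lam - x) * (lam - x)] ->
    `|a - x| < eps ->
  nondecreasing_seq (fun l => iter l.+1 L a) \/
  nonincreasing_seq (fun l => iter l.+1 L a).
Proof.
move=> LP side aP; have [near _] := iterates_cvg LP aP.
suff [above|below] : (forall l, x <= iter l.+1 L a) \/ (forall l, iter l.+1 L a <= x).
- right; apply/nonincreasing_seqP => l.
  have := LP _ (near l.+1); rewrite -iterS.
  have := above l; have := above l.+1 => u v.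
  by rewrite !ger0_norm ?subr_ge0 //; lra.
- left; apply/nondecreasing_seqP => l.
  have := LP _ (near l.+1); rewrite -iterS.
  have := below l; have := below l.+1 => u v.
  by rewrite !ler0_norm ?subr_le0 //; lra.
case: side => side; first by left=> l; apply/side/near.
  by right=> l; apply/side/near.
have stay l : 0 <= (iter l L a - x) * (a - x).
  elim: l => [|l IHl]; first by rewrite -expr2 sqr_ge0.
  have := side _ (near l); have := LP _ (near l); rewrite -iterS.
  move: (iter l.+1 L a) (iter l L a) IHl => u v IHl.
  have [->|v0] := eqVneq (v - x) 0.
    by rewrite normr0 mul0r normr_le0 => /eqP-> _; rewrite mul0r.
  move=> _ uv; have v2 : 0 < (v - x) ^+ 2 by rewrite exprn_even_gt0.
  by rewrite -(pmulr_lge0 _ v2); have := mulr_ge0 uv IHl; congr (0 <= _); ring.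
have [xa|ax|ax] := ltrgtP x a.
- by left=> l; have := stay l.+1; rewrite pmulr_lge0 ?subr_gt0 // subr_ge0.
- by right=> l; have := stay l.+1; rewrite nmulr_lge0 ?subr_lt0 // subr_le0.
left=> l; have := LP _ (near 0); rewrite /= -ax => L0.
have fx : L x = x.
  by move: L0; rewrite subrr normr0 mul0r normr_le0 subr_eq0 => /eqP.
have -> : iter l L x = x by elim: l => // l IHl; rewrite iterS IHl.
by rewrite fx.
Qed.

(** With [m = mu - x] and [t = lam - x], each term, up to its weight, satisfies
      [(m / (t - m)^2 - 1 / m) * t = t^2 * (2 * m^2 - t * m) / (m * (t - m))^2],
    which is nonnegative, and at most quadratic in [t], when [|t| <= |m| / 2].
    So [pull] is Lipschitz at [x] and its difference from its value at [x] has
    the sign of [t], although the signs of the [m] may vary. *)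
Lemma pull_increase (R : realFieldType) (r : seq R) (w : R -> R) (x : R) :
    (forall mu, mu \in r -> 0 < w mu) -> x \notin r ->
  exists C delta : R, [/\ 0 <= C, 0 < delta &
    forall lam, `|lam - x| < delta -> lam \notin r /\
      0 <= (pull r w x lam - pull r w x x) * (lam - x) <= C * (lam - x) ^+ 2].
Proof.
elim: r => [|mu r IHr] wP xr.
  exists 0, 1; split=> // lam _; split=> //.
  by rewrite /pull !big_nil subrr !mul0r lexx.
move: xr; rewrite inE negb_or => /andP[xmu xr].
have [|C [delta [C0 d0 CP]]] := IHr _ xr.
  by move=> nu nur; rewrite wP ?inE ?nur ?orbT.
have w0 : 0 < w mu by rewrite wP ?mem_head.
pose m := mu - x; have m0 : m != 0 by rewrite subr_eq0 eq_sym.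
have m2 : 0 < m ^+ 2 by rewrite exprn_even_gt0.
exists (C + 10 * w mu / m ^+ 2), (Num.min delta (`|m| / 2)).
split; first by rewrite addr_ge0 // divr_ge0 ?ltW // mulr_gt0.
  by rewrite lt_min d0 divr_gt0 // normr_gt0.
move=> lam; rewrite lt_min => /andP[lamd lamm].
have [lamr /andP[lo hi]] := CP lam lamd; set t := lam - x in lamm lo hi *.
have tm : `|t * m| <= m ^+ 2 / 2.
  by rewrite normrM -[m ^+ 2]real_normK ?num_real // expr2 mulrAC ler_wpM2r // ltW.
have lm : lam - mu = t - m by rewrite /t /m; ring.
have tm0 : m ^+ 2 / 4 <= (t - m) ^+ 2.
  by move: tm; rewrite ler_norml => /andP[]; rewrite !expr2; nra.
have tmn : t - m != 0 by apply: contraTneq tm0 => ->; rewrite expr0n /= -ltNge; lra.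
split.
  by rewrite inE negb_or lamr andbT -subr_eq0 lm.
rewrite /pull !big_cons -/(pull r w x lam) -/(pull r w x x) -/m.
have -> : x - mu = - m by rewrite /m opprB.
rewrite lm sqrrN.
set q := (2 * m ^+ 2 - t * m) / (t - m) ^+ 2 / m ^+ 2.
have -> : (m * w mu / (t - m) ^+ 2 + pull r w x lam
    - (m * w mu / m ^+ 2 + pull r w x x)) * t =
    (pull r w x lam - pull r w x x) * t + t ^+ 2 * (w mu * q).
  by rewrite /q; field; rewrite tmn m0.
have num0 : 0 <= 2 * m ^+ 2 - t * m <= 5 / 2 * m ^+ 2.
  by move: tm; rewrite ler_norml => /andP[]; lra.
have tm2 : 0 < (t - m) ^+ 2 by rewrite exprn_even_gt0.
have q0 : 0 <= q <= 10 / m ^+ 2.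
  rewrite /q !divr_ge0 ?sqr_ge0 ?(andP num0).1 //=.
  rewrite ler_pM2r ?invr_gt0 // ler_pdivrMr //.
  by case/andP: num0 => _; lra.
have /andP[qw0 qw1] : 0 <= w mu * q <= 10 * w mu / m ^+ 2.
  case/andP: q0 => q0 q1; rewrite mulr_ge0 ?(ltW w0) //=.
  by rewrite mulrAC [10 / _ * _]mulrC ler_pM2l.
have t2 := sqr_ge0 t.
apply/andP; split; first by rewrite addr_ge0 // mulr_ge0.
by rewrite [leRHS]mulrDl lerD // mulrC ler_wpM2r.
Qed.

Definition settles_at (R : realType) (L : R -> R) (x a : R) : Prop :=
  (nondecreasing_seq (fun l => iter l.+1 L a) \/
   nonincreasing_seq (fun l => iter l.+1 L a)) /\
  (fun l => iter l.+1 L a) @ \oo --> x.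

(** If [S x] is nonzero, then [S] keeps its sign near [x] and [L] maps both
    sides to one of them; if [S x = 0], then [S lam] has the sign of [lam - x]
    and [L] preserves each side. *)
Lemma quadratic_fixpoint_settles (R : realType) (L S : R -> R) (x w C delta : R) :
    0 < w -> 0 <= C -> 0 < delta -> L x = x ->
    (forall lam, lam != x -> `|lam - x| < delta ->
       exists2 D, w <= D & L lam - x = (lam - x) ^+ 2 * S lam / D) ->
    (forall lam, `|lam - x| < delta ->
       0 <= (S lam - S x) * (lam - x) <= C * (lam - x) ^+ 2) ->
  exists2 eps, 0 < eps & forall a, `|a - x| < eps -> settles_at L x a.
Proof.
move=> w0 C0 d0 Lx LP SP; set sigma := S x in SP.
have K0 : 0 < 2 * (`|sigma| + C + 1) by have := normr_ge0 sigma; lra.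
(* Within this distance [|S lam - S x| <= |S x|], so that [S] keeps the sign
   of [S x]. *)
pose e_sign := if sigma == 0 then 1 else `|sigma| / (C + 1).
have es0 : 0 < e_sign.
  rewrite /e_sign; case: eqVneq => // s0.
  by rewrite divr_gt0 ?normr_gt0 //; lra.
pose eps := Num.min (Num.min delta 1) (Num.min (w / (2 * (`|sigma| + C + 1))) e_sign).
have S_lip lam : `|lam - x| < eps -> `|S lam - sigma| <= C * `|lam - x|.
  rewrite !lt_min => /andP[/andP[ld _] _]; have /andP[lo hi] := SP _ ld.
  have [->|lx] := eqVneq lam x; first by rewrite !subrr normr0 mulr0.
  rewrite -(ler_pM2r (x := `|lam - x|)) ?normr_gt0 ?subr_eq0 //.
  by rewrite -normrM ger0_norm // -mulrA -expr2 real_normK ?num_real.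
have contract lam : `|lam - x| < eps -> `|L lam - x| <= `|lam - x| / 2.
  move=> near; have := S_lip _ near.
  move: near; rewrite !lt_min => /andP[/andP[ld l1] /andP[lw _]] lip.
  have [->|lx] := eqVneq lam x; first by rewrite Lx subrr normr0 mul0r.
  have [D wD ->] := LP _ lx ld.
  have D0 : 0 < D := lt_le_trans w0 wD.
  rewrite !normrM normfV (gtr0_norm D0) ler_pdivrMr // -!mulrA.
  rewrite ler_wpM2l //.
  have S_le : `|S lam| <= `|sigma| + C + 1.
    have := ler_normD (S lam - sigma) sigma; rewrite subrK.
    have : C * `|lam - x| <= C by rewrite -[leRHS]mulr1 ler_wpM2l // ltW.
    by move: lip; lra.
  have := ler_wpM2l (normr_ge0 (lam - x)) S_le.
  by move: lw wD; rewrite ltr_pdivlMr //; lra.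
have side : [\/ forall lam, `|lam - x| < eps -> x <= L lam,
    forall lam, `|lam - x| < eps -> L lam <= x |
    forall lam, `|lam - x| < eps -> 0 <= (L lam - x) * (lam - x)].
  have sign lam : sigma != 0 -> `|lam - x| < eps -> `|S lam - sigma| <= `|sigma|.
    move=> s0 near; rewrite (le_trans (S_lip _ near)) //.
    move: near; rewrite /eps /e_sign (negbTE s0) !lt_min => /andP[_ /andP[_ ls]].
    rewrite ltr_pdivlMr in ls; last by lra.
    by rewrite (le_trans _ (ltW ls)) // mulrC ler_wpM2l //; lra.
  have near_d lam : `|lam - x| < eps -> `|lam - x| < delta.
    by rewrite !lt_min => /andP[/andP[]].
  case: (ltrgtP sigma 0) => [s0|s0|s0].
  - constructor 2 => lam near; have [->|lx] := eqVneq lam x; first by rewrite Lx.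
    rewrite -subr_le0; have [D wD ->] := LP _ lx (near_d _ near).
    rewrite pmulr_lle0 ?invr_gt0 ?(lt_le_trans w0) // mulr_ge0_le0 ?sqr_ge0 //.
    have := sign _ (ltr0_neq0 s0) near; rewrite (ltr0_norm s0) ler_norml; lra.
  - constructor 1 => lam near; have [->|lx] := eqVneq lam x; first by rewrite Lx.
    rewrite -subr_ge0; have [D wD ->] := LP _ lx (near_d _ near).
    rewrite pmulr_lge0 ?invr_gt0 ?(lt_le_trans w0) // mulr_ge0 ?sqr_ge0 //.
    have := sign _ (lt0r_neq0 s0) near; rewrite (gtr0_norm s0) ler_norml; lra.
  - constructor 3 => lam near.
    have [->|lx] := eqVneq lam x; first by rewrite subrr mulr0.
    have [D wD ->] := LP _ lx (near_d _ near).
    have /andP[lo _] := SP _ (near_d _ near); rewrite s0 subr0 in lo.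
    have -> : (lam - x) ^+ 2 * S lam / D * (lam - x) =
      (lam - x) ^+ 2 * (S lam * (lam - x)) / D by ring.
    apply: divr_ge0; last exact: le_trans (ltW w0) wD.
    by apply: mulr_ge0 => //; apply: sqr_ge0.
exists eps; first by rewrite !lt_min d0 ltr01 es0 divr_gt0.
move=> a near; split; first exact: iterates_monotone contract side near.
by rewrite (cvg_shiftS (fun l => iter l L a)); case: (iterates_cvg contract near).
Qed.

Lemma rayleigh_settles (R : realType) n (pi nu : nat -> R) (x : R) :
    (1 <= n)%N -> weighted_path n pi nu ->
    x \in rootsR (char_poly (path_matrix n pi nu)) -> 0 < x ->
  exists2 eps, 0 < eps &
    forall a, `|a - x| < eps -> settles_at (rayleigh n pi nu) x a.
Proof.
move=> n1 path xs x0; set spec := rootsR _ in xs.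
pose r := [seq mu <- spec | mu != 0 & mu != x].
pose w := end_weight n pi nu.
have rw mu : mu \in r -> 0 < w mu.
  by rewrite mem_filter => /andP[_ mus]; apply: end_weight_gt0.
have xr : x \notin r by rewrite mem_filter eqxx andbF.
have [C [delta [C0 d0 CP]]] := pull_increase rw xr.
(* The bound [x] on the distance keeps [lam] away from the eigenvalue 0. *)
apply: (@quadratic_fixpoint_settles _ _ (pull r w x) x (w x) C (Num.min delta x)) => //.
- exact: end_weight_gt0.
- by rewrite lt_min d0.
- exact: rayleigh_fixed.
- move=> lam lx; rewrite lt_min => /andP[ld l0]; have [lamr _] := CP _ ld.
  have lam0 : lam != 0.
    by apply: contraTneq l0 => ->; rewrite sub0r normrN gtr0_norm ?ltxx.
  have lams : lam \notin spec by apply: contra lamr => ls; rewrite mem_filter lam0 lx.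
  exists (w x + (lam - x) ^+ 2 * \sum_(mu <- r) w mu / (lam - mu) ^+ 2).
    rewrite lerDl mulr_ge0 ?sqr_ge0 // big_seq sumr_ge0 // => mu /rw mu0.
    by rewrite divr_ge0 ?sqr_ge0 // ltW.
  exact: rayleigh_displacement.
- by move=> lam; rewrite lt_min => /andP[/CP[]].
Qed.

Lemma common_radius (R : realType) (n : nat) (Q : nat -> R -> Prop) :
    (forall i, (1 <= i < n)%N ->
       exists2 eps, 0 < eps & forall t, `|t| < eps -> Q i t) ->
  exists2 eps, 0 < eps & forall i t, (1 <= i < n)%N -> `|t| < eps -> Q i t.
Proof.
elim: n => [|n IHn] QP; first by exists 1 => // i t; rewrite ltn0 andbF.
have [i /andP[i1 iN]|e e0 eP] := IHn; first by apply: QP; rewrite i1 ltnW.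
have [n0|n0] := leqP n 0.
  by exists 1 => // i t /andP[i1]; rewrite ltnS => /leq_trans/(_ n0); rewrite leqNgt i1.
have [d d0 dP] := QP n (introT andP (conj n0 (leqnn _))).
exists (Num.min e d); first by rewrite lt_min e0.
move=> i t /andP[i1]; rewrite ltnS leq_eqVlt lt_min => /orP[/eqP->|iN] /andP[te td].
  exact: dP.
by apply: eP; rewrite ?i1.
Qed.

Theorem theorem3p14 (R : realType) (n : nat) (pi nu : nat -> R)
    (n_ge2 : (2 <= n)%N) (path : weighted_path n pi nu) :
  exists2 eps : R, 0 < eps &
    forall (i : nat) (lam0 : R),
      (1 <= i <= n.-1)%N ->
      0 < lam0 ->
      path_eigenvalue n pi nu i - eps < lam0 < path_eigenvalue n pi nu i + eps ->
      let lam : nat -> R := fun l => iter l (rayleigh n pi nu) lam0 in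
      let lam_from1 : nat -> R := fun l => lam l.+1 in
      (nondecreasing_seq lam_from1 \/ nonincreasing_seq lam_from1)
      /\ lam_from1 @ \oo --> path_eigenvalue n pi nu i.
Proof.
have n_ge1 : (1 <= n)%N := ltnW n_ge2.
pose x := path_eigenvalue n pi nu.
have [i iP|eps eps0 epsP] := @common_radius R n
    (fun i t => settles_at (rayleigh n pi nu) (x i) (x i + t)).
  have [xs x0] := path_eigenvalue_gt0 n_ge1 path iP.
  have [eps eps0 epsP] := rayleigh_settles n_ge1 path xs x0.
  by exists eps => // t tP; apply: epsP; rewrite addrAC subrr add0r.
exists eps => // i lam0 /andP[i1 iN] _ near.
have := epsP i (lam0 - x i); rewrite [x i + _]addrC subrK; apply.
  by rewrite i1 -[n]prednK // ltnS.
by rewrite ltr_norml ltrBlDl ltrBDl.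
Qed.
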